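(* Let $n,m\ge1$ be integers and let $T\in B(\mathcal H)$ be a contraction ($\|T\|\le1$) such that $T\in[(n,m)DN]$ and $T$ is an $m$-partial isometry. Then $T\in[(1,1)DN]$, and $T$ has a representation $T=U\oplus T_0$ with respect to a decomposition $\mathcal H=\mathcal H_1\oplus\mathcal H_0$, where $U\in B(\mathcal H_1)$ is unitary and $T_0\in B(\mathcal H_0)$ is nilpotent.
   Context: $\mathcal H$ is a complex infinite dimensional Hilbert space and $B(\mathcal H)$ is the algebra of bounded linear operators on $\mathcal H$; $[X,Y]=XY-YX$ and $T^{*m}=(T^* )^m$. An operator $T\in B(\mathcal H)$ is Drazin invertible if there is $T_d\in B(\mathcal H)$ (the Drazin inverse) with $[T_d,T]=0$, $T_d^2T=T_d$ and $T^{p+1}T_d=T^p$ for some integer $p\ge1$ (if $T$ is invertible, $T_d=T^{-1}$). For positive integers $r,s$, $T\in[(r,s)DN]$ means that $T$ is Drazin invertible and $[T_d^r,T^{*s}]=0$. An operator $T$ is an $m$-partial isometry if $T^mT^{*m}T^m=T^m$. One of the summands $\mathcal H_1,\mathcal H_0$ may be $\{0\}$. *)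

(* Defs.v *)
From HB Require Import structures.
From mathcomp Require Import all_boot all_order all_algebra.
From mathcomp Require Import sesquilinear complex ring lra.
From mathcomp Require Import all_classical all_reals all_analysis.

Set Implicit Arguments.
Unset Strict Implicit.
Unset Printing Implicit Defensive.

Import Order.TTheory GRing.Theory Num.Theory.
Import numFieldNormedType.Exports.

Local Open Scope classical_set_scope.
Local Open Scope ring_scope.

(* MathComp / MathComp-Analysis. The complex scalars are R[i] for R : realType.
   The inner product is linear in its first argument and conjugate-linear in
   the second one, and it induces the norm of the complete normed module. *)
HB.mixin Record CompleteNormedModule_isHilbert (R : realType) H
    & CompleteNormedModule R[i] H := {
  inner : {dot H for (@Num.conj R[i])};
  inner_norm : forall x : H, `|x| ^+ 2 = inner x x
}.

#[short(type="hilbertType")]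
HB.structure Definition Hilbert (R : realType) :=
  {H of CompleteNormedModule R[i] H & CompleteNormedModule_isHilbert R H}.

Section HilbertTheory.
Context (R : realType) (H : hilbertType R).
Implicit Types (x y z u v : H).

Lemma innerC x y : inner x y = (inner y x)^*.
Proof. by have := hermC inner x y; rewrite expr0 mul1r. Qed.

Lemma norm2_proj u v : v != 0 ->
  `|u - (inner u v / inner v v) *: v| ^+ 2 =
  `|u| ^+ 2 - `|inner u v| ^+ 2 / `|v| ^+ 2.
Proof.
move=> v0; rewrite !inner_norm; set a := _ / _.
have vv0 : inner v v != 0 by rewrite dnorm_eq0.
have vvJ : (inner v v)^* = inner v v by rewrite geC0_conj ?dnorm_ge0.
have aJ : a^* * inner u v = `|inner u v| ^+ 2 / inner v v.
  by rewrite /a rmorphM fmorphV /= vvJ normCK mulrAC [_^* * _]mulrC.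
have sJ : (`|inner u v| ^+ 2 / inner v v)^* = `|inner u v| ^+ 2 / inner v v.
  by rewrite geC0_conj // divr_ge0 ?dnorm_ge0 ?exprn_ge0.
rewrite dnormB dnormZ linearZr_LR /= aJ sJ.
rewrite normrM normfV [`|inner v v|]ger0_norm ?dnorm_ge0 //.
by field.
Qed.

Lemma Cauchy_Schwarz u v : `|inner u v| <= `|u| * `|v|.
Proof.
have [->|v0] := eqVneq v 0.
  by rewrite linear0 !normr0 mulr0.
have := exprn_ge0 2 (normr_ge0 (u - (inner u v / inner v v) *: v)).
rewrite norm2_proj // subr_ge0 ler_pdivrMr ?exprn_gt0 ?normr_gt0 //.
by rewrite -exprMn ler_pXn2r // nnegrE ?mulr_ge0.
Qed.

Lemma inner_norm_parallelogram u v :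
  `|u - v| ^+ 2 = 2 * `|u| ^+ 2 + 2 * `|v| ^+ 2 - `|u + v| ^+ 2.
Proof. by rewrite !inner_norm dnormB dnormD; ring. Qed.

Let rn x : R := complex.Re `|x|.

Let rnE x : `|x| = ((rn x)%:C)%C.
Proof. by rewrite RRe_real // normr_real. Qed.

Let rn_ge0 x : 0 <= rn x. Proof. by rewrite -ler0c -rnE. Qed.

Lemma inner_inj y z : (forall x, inner x y = inner x z) -> y = z.
Proof.
move=> yz; apply/eqP; rewrite -subr_eq0 -(dnorm_eq0 (@inner R H)).
by rewrite linearBr /= yz subrr.
Qed.

Lemma Riesz (f : {scalar H}) (M : R) :
  (forall x, `|f x| <= (M%:C)%C * `|x|) -> exists z, forall x, f x = inner x z.
Proof.
move=> fM.
have [f0|] := pselect (forall x, f x = 0).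
  by exists 0 => x; rewrite f0 linear0.
move=> /existsNP[x1 /eqP fx1].
pose x0 := (f x1)^-1 *: x1.
have fx0 : f x0 = 1 by rewrite /x0 linearZ /= mulVf.
pose D := [set rn x | x in [set x | f x = 1]].
have D0 : D !=set0 by exists (rn x0), x0.
have Dlb : lbound D 0 by move=> _ [x _ <-].
have Dinf : has_inf D by split => //; exists 0.
pose d := inf D.
have d0 : 0 <= d by apply: lb_le_inf.
have dD x : f x = 1 -> d <= rn x.
  by move=> fx; apply: ge_inf; [exists 0|exists x].
have ex (n : nat) : exists x, f x = 1 /\ rn x < d + n.+1%:R^-1.
  have n0 : 0 < n.+1%:R^-1 :> R by rewrite invr_gt0.
  by have [_ [x fx <-] xd] := inf_adherent n0 Dinf; exists x.
have [u /all_and2[fu ud]] := choice ex.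
have mid x y (e : R) : 0 <= e -> e <= 1 -> f x = 1 -> f y = 1 -> rn x < d + e ->
    rn y < d + e -> rn (x - y) ^+ 2 <= (8 * d + 4) * e.
  move=> e0 e1 fx fy xe ye.
  have m1 : f (2^-1 *: (x + y)) = 1.
    by rewrite linearZ /= linearD /= fx fy mulVf // pnatr_eq0.
  have dm := dD _ m1.
  have rnm : rn (x + y) = 2 * rn (2^-1 *: (x + y)).
    apply: complexI; rewrite rmorphM /= -!rnE normrZ normfV rmorph_nat normr_nat.
    by rewrite mulrA mulfV ?mul1r // pnatr_eq0.
  have pl : rn (x - y) ^+ 2 =
      2 * rn x ^+ 2 + 2 * rn y ^+ 2 - rn (x + y) ^+ 2.
    apply: complexI; rewrite !(rmorphB, rmorphD, rmorphM, rmorphXn, rmorph_nat) /=.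
    rewrite -!rnE -!expr2; exact: inner_norm_parallelogram.
  have := rn_ge0 x; have := rn_ge0 y; nra.
have cu : cauchy (u @ \oo).
  apply: (@cauchy_exP R[i] H) => e e0.
  have eE : e = ((complex.Re e)%:C)%C by rewrite RRe_real // gtr0_real.
  move: (complex.Re e) eE => r eE.
  have r0 : 0 < r by rewrite -ltcR -eE.
  have [N] : exists N : nat, (8 * d + 4) * N.+1%:R^-1 < r ^+ 2.
    have k0 : 0 < r ^+ 2 / (8 * d + 4) by apply: divr_gt0; nra.
    near \oo => N; exists N.
    rewrite mulrC -ltr_pdivlMr; last lra.
    near: N; exact: near_infty_natSinv_lt (PosNum k0).
  move=> Nr; exists (u N).
  exists N => // k /= Nk.
  rewrite -ball_normE /= eE rnE ltcR.
  have : rn (u N - u k) ^+ 2 <= (8 * d + 4) * N.+1%:R^-1.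
    apply: mid => //.
    - by rewrite invf_le1 ?ler1n.
    - apply: lt_le_trans (ud k) _; rewrite lerD2l lef_pV2 ?posrE //.
      by rewrite ler_nat.
  move: (rn_ge0 (u N - u k)) Nr; set a := rn _ => a0 Nr ar.
  by rewrite -(ltr_pXn2r (isT : (0 < 2)%N)) ?nnegrE ?(le_lt_trans ar Nr) // ltW.
have /cvg_ex[z uz] : cvg (u @ \oo)
  by exact: (@cauchy_cvg H (u @ \oo) _ cu).
have appr (e : R) : 0 < e -> exists n, rn (z - u n) < e /\ rn (u n) < d + e.
  move=> e0; have ec0 : 0 < (e%:C)%C by rewrite ltcR.
  move/cvgrPdist_lt: uz => /(_ _ ec0) uz.
  near \oo => n; exists n; split.
    by rewrite -ltcR -rnE; near: n.
  apply: lt_le_trans (ud n) _; rewrite lerD2l ltW //.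
  near: n; exact: near_infty_natSinv_lt (PosNum e0).
have fz : f z = 1.
  apply/eqP; rewrite -subr_eq0 -normr_le0.
  have fE n : `|f z - 1| <= ((M * rn (z - u n))%:C)%C.
    by rewrite rmorphM /= -rnE -(fu n) -raddfB fM.
  have := normr_real (f z - 1); move/RRe_real.
  set t := complex.Re _ => tE; rewrite -tE lecR leNgt; apply/negP => t0.
  have M0 : 0 < `|M| + 1 by rewrite ltr_wpDl.
  have [n [zn _]] := appr _ (divr_gt0 t0 M0).
  have := fE n; rewrite -tE lecR leNgt => /negP; apply.
  move: zn; rewrite ltr_pdivlMr //.
  have := rn_ge0 (z - u n); have := ler_norm M; nra.
have zd : rn z <= d.
  apply/ler_addgt0Pr => e e0.
  have [n [zn un]] := appr (e / 2) ltac:(lra).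
  have : rn z <= rn (z - u n) + rn (u n).
    by rewrite -lecR rmorphD /= -!rnE -{1}(subrK (u n) z) ler_normD.
  lra.
have z0 : z != 0.
  by apply/eqP => z0; move: fz; rewrite z0 linear0 => /esym/eqP; rewrite oner_eq0.
have zz0 : inner z z != 0 by rewrite dnorm_eq0.
have orth w : f w = 0 -> inner z w = 0.
  move=> fw; have [->|w0] := eqVneq w 0; first by rewrite linear0.
  have fp : f (z - (inner z w / inner w w) *: w) = 1.
    by rewrite linearB linearZ /= fw mulr0 subr0.
  have := le_trans zd (dD _ fp).
  rewrite -lecR -!rnE -(ler_pXn2r (isT : (0 < 2)%N)) ?nnegrE //.
  rewrite norm2_proj // lerBrDr gerDl.
  rewrite pmulr_lle0 ?invr_gt0 ?exprn_gt0 ?normr_gt0 //.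
  by rewrite -normrX normr_le0 sqrf_eq0 => /eqP.
exists ((inner z z)^-1 *: z) => x.
have : inner z (x - f x *: z) = 0.
  by apply: orth; rewrite linearB linearZ /= fz mulr1 subrr.
rewrite linearBr /= linearZr_LR /= => /eqP; rewrite subr_eq0 => /eqP zx.
have xz : inner x z = f x * inner z z.
  rewrite innerC zx rmorphM /= conjCK.
  by rewrite (geC0_conj (dnorm_ge0 inner z)).
rewrite linearZr_LR /= fmorphV /= geC0_conj ?dnorm_ge0 //.
by rewrite xz mulrCA mulVf ?mulr1.
Unshelve. all: by end_near. Qed.

End HilbertTheory.

(* The algebra B(H), with composition as product. It is only a pzRingType (a
   ring in which 1 = 0 is allowed) because H may be the zero space. *)
Record boundedOp (R : realType) (H : hilbertType R) := BoundedOp {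
  op_fun :> H -> H;
  op_linear : linear op_fun;
  op_bounded : exists M : R, forall x, `|op_fun x| <= (M%:C)%C * `|x| }.

HB.instance Definition _ (R : realType) (H : hilbertType R) (T : boundedOp H) :=
  GRing.isLinear.Build R[i] H H _ T (op_linear T).
HB.instance Definition _ (R : realType) (H : hilbertType R) :=
  gen_eqMixin (boundedOp H).
HB.instance Definition _ (R : realType) (H : hilbertType R) :=
  gen_choiceMixin (boundedOp H).

Section BoundedOpAlgebra.
Context (R : realType) (H : hilbertType R).
Implicit Types (S T : boundedOp H) (a : R[i]).

Lemma op_ext S T : S =1 T -> S = T.
Proof.
case: S T => [f fl fb] [g gl gb] /funext /= fg.
by case: _ / fg in gl gb *; congr BoundedOp; exact: Prop_irrelevance.
Qed.

Lemma op_boundedE T :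
  exists2 M : R, 0 <= M & forall x, `|T x| <= (M%:C)%C * `|x|.
Proof.
have [M TM] := op_bounded T; exists `|M| => // x.
apply: (le_trans (TM x)); apply: ler_wpM2r => //.
by rewrite lecR ler_norm.
Qed.

Fact op0_linear : linear (fun _ : H => 0 : H).
Proof. by move=> a x y; rewrite scaler0 addr0. Qed.
Fact op0_bounded : exists M : R, forall x : H, `|0 : H| <= (M%:C)%C * `|x|.
Proof. by exists 0 => x; rewrite normr0 mul0r. Qed.
Definition op0 := BoundedOp op0_linear op0_bounded.

Fact op1_linear : linear (fun x : H => x).
Proof. by []. Qed.
Fact op1_bounded : exists M : R, forall x : H, `|x| <= (M%:C)%C * `|x|.
Proof. by exists 1 => x; rewrite rmorph1 mul1r. Qed.
Definition op1 := BoundedOp op1_linear op1_bounded.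

Fact op_opp_linear T : linear (fun x : H => - T x).
Proof. by move=> a x y; rewrite linearP opprD scalerN. Qed.
Fact op_opp_bounded T : exists M : R, forall x : H, `|- T x| <= (M%:C)%C * `|x|.
Proof. by have [M TM] := op_bounded T; exists M => x; rewrite normrN. Qed.
Definition op_opp T := BoundedOp (op_opp_linear T) (op_opp_bounded T).

Fact op_add_linear S T : linear (fun x : H => S x + T x).
Proof. by move=> a x y; rewrite !linearP scalerDr addrACA. Qed.
Fact op_add_bounded S T :
  exists M : R, forall x : H, `|S x + T x| <= (M%:C)%C * `|x|.
Proof.
have [M SM] := op_bounded S; have [N TN] := op_bounded T.
exists (M + N) => x; rewrite rmorphD /= mulrDl.
by apply: (le_trans (ler_normD _ _)); exact: lerD.
Qed.
Definition op_add S T := BoundedOp (op_add_linear S T) (op_add_bounded S T).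

Fact op_mul_linear S T : linear (fun x : H => S (T x)).
Proof. by move=> a x y; rewrite !linearP. Qed.
Fact op_mul_bounded S T :
  exists M : R, forall x : H, `|S (T x)| <= (M%:C)%C * `|x|.
Proof.
have [M M0 SM] := op_boundedE S; have [N TN] := op_bounded T.
exists (M * N) => x; rewrite rmorphM /= -mulrA.
by apply: (le_trans (SM _)); apply: ler_wpM2l; rewrite ?ler0c.
Qed.
Definition op_mul S T := BoundedOp (op_mul_linear S T) (op_mul_bounded S T).

Fact op_addA : associative op_add.
Proof. by move=> S T U; apply: op_ext => x /=; rewrite addrA. Qed.
Fact op_addC : commutative op_add.
Proof. by move=> S T; apply: op_ext => x /=; rewrite addrC. Qed.
Fact op_add0 : left_id op0 op_add.
Proof. by move=> T; apply: op_ext => x /=; rewrite add0r. Qed.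
Fact op_addN : left_inverse op0 op_opp op_add.
Proof. by move=> T; apply: op_ext => x /=; rewrite addNr. Qed.
HB.instance Definition _ :=
  GRing.isZmodule.Build (boundedOp H) op_addA op_addC op_add0 op_addN.

Fact op_mulA : associative op_mul.
Proof. by move=> S T U; apply: op_ext. Qed.
Fact op_mul1l : left_id op1 op_mul.
Proof. by move=> T; apply: op_ext. Qed.
Fact op_mul1r : right_id op1 op_mul.
Proof. by move=> T; apply: op_ext. Qed.
Fact op_mulDl : left_distributive op_mul op_add.
Proof. by move=> S T U; apply: op_ext. Qed.
Fact op_mulDr : right_distributive op_mul op_add.
Proof. by move=> S T U; apply: op_ext => x /=; rewrite linearD. Qed.
HB.instance Definition _ := GRing.Zmodule_isPzRing.Build (boundedOp H)
  op_mulA op_mul1l op_mul1r op_mulDl op_mulDr.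

Lemma op_mulE S T x : (S * T) x = S (T x).
Proof. by []. Qed.

Lemma adjoint_subproof T :
  {S : boundedOp H | forall x y, inner (T x) y = inner x (S y)}.
Proof.
apply: cid.
have [M M0 TM] := op_boundedE T.
have ex y : exists z, forall x, inner (T x) y = inner x z.
  pose f x := inner (T x) y.
  have fl : linear_for *%R f.
    by move=> a u v; rewrite /f linearP linearDl linearZl_LR.
  pose fL := GRing.isLinear.Build R[i] H R[i] _ f fl.
  pose F : {scalar H} := HB.pack f fL.
  have FM x : `|F x| <= ((M * complex.Re `|y|)%:C)%C * `|x|.
    rewrite rmorphM /= RRe_real ?normr_real // mulrAC.
    by apply: (le_trans (Cauchy_Schwarz _ _)); exact: ler_wpM2r.
  by have [z zP] := Riesz FM; exists z.
have [S SP] := choice ex.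
have Sl : linear S.
  move=> a u v; apply: inner_inj => x.
  by rewrite -SP linearDr linearZr_LR /= !SP linearDr linearZr_LR.
have Sb : exists M : R, forall x, `|S x| <= (M%:C)%C * `|x|.
  exists M => y; have [->|Sy0] := eqVneq (S y) 0.
    by rewrite normr0 mulr_ge0 // ler0c.
  rewrite -(ler_pM2r (_ : 0 < `|S y|)) ?normr_gt0 // -expr2 inner_norm -SP.
  rewrite -[X in X <= _](ger0_norm (_ : 0 <= inner _ _)); last first.
    by rewrite SP dnorm_ge0.
  apply: (le_trans (Cauchy_Schwarz _ _)); rewrite mulrAC.
  exact: ler_wpM2r.
by exists (BoundedOp Sl Sb) => x y /=.
Qed.

Definition adjoint T := sval (adjoint_subproof T).

Lemma adjointP T x y : inner (T x) y = inner x (adjoint T y).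
Proof. exact: svalP (adjoint_subproof T) x y. Qed.

End BoundedOpAlgebra.

(* A closed subspace of H is itself a Hilbert space for the restricted
   operations, so that boundedOp M is B(M) and adjoints of its elements are
   taken within M. *)
Record closedSubspace (R : realType) (H : hilbertType R) := ClosedSubspace {
  csub_set : set H;
  csub_closed : closed csub_set;
  csub_submod : GRing.submod_closed (mem csub_set) }.

Section ClosedSubspace.
Context (R : realType) (H : hilbertType R) (M : closedSubspace H).

Definition csub_type := {x : H | x \in csub_set M}.
HB.instance Definition _ := SubChoice.on csub_type.
HB.instance Definition _ := GRing.SubChoice_isSubLmodule.Build R[i] H
  (mem (csub_set M)) csub_type (GRing.submod_closed_semi (csub_submod M)).

Definition csub_norm (x : csub_type) : R[i] := `|val x|.
Fact csub_normD x y : csub_norm (x + y) <= csub_norm x + csub_norm y.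
Proof. exact: ler_normD. Qed.
Fact csub_normZ a x : csub_norm (a *: x) = `|a| * csub_norm x.
Proof. exact: normrZ. Qed.
Fact csub_norm0_eq0 x : csub_norm x = 0 -> x = 0.
Proof. by move=> /normr0_eq0 x0; apply: val_inj. Qed.
HB.instance Definition _ :=
  Lmodule_isNormed.Build R[i] csub_type csub_normD csub_normZ csub_norm0_eq0.

Fact csub_complete (F : set_system csub_type) :
  ProperFilter F -> cauchy F -> cvg F.
Proof.
move=> FF Fc.
have vc : cauchy ((val : csub_type -> H) @ F).
  apply: (@cauchy_exP R[i] H) => e e0.
  have [x Fx] := (@cauchyP R[i] csub_type F FF).1 Fc e e0.
  exists (val x); apply: (@filterS _ F _ (ball x e)) Fx => y.
  by rewrite /= -!ball_normE.
have /cvg_ex[l Fl] : cvg ((val : csub_type -> H) @ F) by exact: (cauchy_cvg _ vc).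
have Ml : l \in csub_set M.
  rewrite inE; apply: (closed_cvg (csub_set M) (csub_closed (c:=M)) _ _ Fl).
  by apply: nearW => x; have := valP x; rewrite inE.
apply/cvg_ex; exists (exist _ l Ml : csub_type).
apply/cvgrPdist_lt => e e0.
by move/cvgrPdist_lt : Fl; apply.
Qed.
HB.instance Definition _ := Uniform_isComplete.Build csub_type csub_complete.

Definition csub_inner (x y : csub_type) : R[i] := inner (val x) (val y).
Fact csub_inner_linearl y : linear_for *%R (csub_inner^~ y).
Proof. by move=> a u v; rewrite /csub_inner linearP linearDl linearZl_LR. Qed.
Fact csub_inner_linearr x :
  linear_for ((@Num.conj R[i]) \; *%R) (csub_inner x).
Proof.
by move=> a u v; rewrite /csub_inner [X in inner _ X]linearP linearDr linearZr_LR.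
Qed.
HB.instance Definition _ := bilinear_isBilinear.Build R[i] csub_type csub_type
  R[i] *%R ((@Num.conj R[i]) \; *%R) csub_inner
  (conj csub_inner_linearl csub_inner_linearr).
Fact csub_inner_herm x y :
  csub_inner x y = (-1) ^+ false * (csub_inner y x)^*.
Proof. exact: hermC. Qed.
HB.instance Definition _ := isHermitianSesquilinear.Build R[i] csub_type
  false (@Num.conj R[i]) csub_inner csub_inner_herm.
Fact csub_inner_gt0 x : x != 0 -> 0 < csub_inner x x.
Proof. by move=> x0; apply: neq0_dnorm_gt0. Qed.
HB.instance Definition _ :=
  isDotProduct.Build R[i] csub_type csub_inner csub_inner_gt0.

Fact csub_inner_norm (x : csub_type) : `|x| ^+ 2 = csub_inner x x.
Proof. exact: inner_norm. Qed.
HB.instance Definition _ :=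
  CompleteNormedModule_isHilbert.Build R csub_type csub_inner_norm.
End ClosedSubspace.

Coercion csub_type : closedSubspace >-> Sortclass.

Section Notions.
Context (R : realType) (H : hilbertType R).
Implicit Types (S T : boundedOp H) (r s m : nat).

(* No finite family spans H. *)
Definition infinite_dim : Prop :=
  ~ exists n (e : 'I_n -> H), forall x, exists c : 'I_n -> R[i],
      x = \sum_i c i *: e i.

Definition opnorm T : R :=
  inf [set M : R | 0 <= M /\ forall x, `|T x| <= (M%:C)%C * `|x|].

(* The infimum is over a nonempty set of reals bounded below by 0, so it is not
   the default value of inf. *)
Lemma le_opnorm T x : `|T x| <= ((opnorm T)%:C)%C * `|x|.
Proof.
have [->|x0] := eqVneq x 0; first by rewrite linear0 !normr0 mulr0.
rewrite -ler_pdivrMr ?normr_gt0 //.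
pose q := complex.Re (`|T x| / `|x|).
have qE : `|T x| / `|x| = (q%:C)%C by rewrite RRe_real // ger0_real ?divr_ge0.
rewrite qE lecR; apply: lb_le_inf; first by have [M M0 TM] := op_boundedE T; exists M.
by move=> M [_ TM]; rewrite -lecR -qE ler_pdivrMr ?normr_gt0.
Qed.

Definition op_contraction T : Prop := opnorm T <= 1.

Definition commutator S T : boundedOp H := S * T - T * S.

Definition is_drazin_inverse T Td : Prop :=
  [/\ commutator Td T = 0, Td ^+ 2 * T = Td &
      exists2 p, (1 <= p)%N & T ^+ p.+1 * Td = T ^+ p].

(* The class [(r,s)DN]; the Drazin inverse is unique when it exists. *)
Definition DN r s T : Prop :=
  exists2 Td, is_drazin_inverse T Td &
    commutator (Td ^+ r) (adjoint T ^+ s) = 0.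

Definition partial_isometry m T : Prop :=
  T ^+ m * adjoint T ^+ m * T ^+ m = T ^+ m.

Definition is_unitary T : Prop := adjoint T * T = 1 /\ T * adjoint T = 1.

Definition is_nilpotent T : Prop := exists2 k, (1 <= k)%N & T ^+ k = 0.

Definition orthogonal_decomposition (H1 H0 : closedSubspace H) : Prop :=
  (forall (x : H1) (y : H0), inner (val x) (val y) = 0) /\
  (forall z : H, exists (x : H1) (y : H0), z = val x + val y).

End Notions.

(* T = U (+) T0 with respect to H = H1 (+) H0. *)
Definition is_direct_sum (R : realType) (H : hilbertType R)
    (H1 H0 : closedSubspace H)
    (T : boundedOp H) (U : boundedOp H1) (T0 : boundedOp H0) : Prop :=
  forall (x : H1) (y : H0), T (val x + val y) = val (U x) + val (T0 y).

Arguments infinite_dim {R} H.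

(* Main.v *)
From mathcomp Require Import all_boot all_order all_algebra.
From mathcomp Require Import sesquilinear complex.
From mathcomp Require Import all_classical all_reals all_analysis.
Require Import Defs.

(** Let [D] be the Drazin inverse and [P = T D] the spectral idempotent. Since
    [P] lies in the double commutant of [D^n], it commutes with [T*^m]; hence
    [P*] commutes with the powers of [T^m], and therefore with [P]. A normal
    idempotent is self-adjoint, so [ran P] and [ker P] are orthogonal reducing
    subspaces. Cancelling [T^m] on [ran P] in the partial isometry identity
    gives [T*^m P = D^m], so [T^m], and then the contraction [T], is isometric
    on [ran P]; being invertible there, it is unitary. On [ker P] it is
    nilpotent. *)

Set Implicit Arguments.
Unset Strict Implicit.
Unset Printing Implicit Defensive.

Import Order.TTheory GRing.Theory Num.Theory.
Import numFieldNormedType.Exports.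

Local Open Scope classical_set_scope.
Local Open Scope ring_scope.

(** Sliding [y] past [a] and inserting [a * b * a] for [a] gives
    [y * (a * b) = a * b * y * (a * b)]. The same computation with [b * a] in place of [a * b]
    absorbs the right-hand factor. *)
Lemma comm_group_idempotent (A : pzRingType) (a b y : A) :
  GRing.comm a b -> a * b * a = a -> GRing.comm y a -> GRing.comm y (a * b).
Proof.
move=> ab aba ya; rewrite /GRing.comm.
have -> : y * (a * b) = a * b * y * (a * b).
  by rewrite -(mulrA (a * b)) [in RHS](mulrA y) ya !mulrA aba -ya.
by rewrite ab -(mulrA b a y) -ya -!mulrA (mulrA a b a) aba.
Qed.

Section DrazinAlgebra.
Context (A : pzRingType) (t d : A).
Hypotheses (dt : d * t = t * d) (d2t : d ^+ 2 * t = d).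

Lemma drazin_idem : t * d * (t * d) = t * d.
Proof. by rewrite -[LHS]mulrA -[in LHS]dt (mulrA d d) -expr2 d2t. Qed.

Lemma drazin_exprM k : (1 <= k)%N -> t ^+ k * d ^+ k = t * d.
Proof.
case: k => // k _; rewrite -exprMn_comm //.
by elim: k => [|k IH]; rewrite ?expr1 // exprS IH drazin_idem.
Qed.

End DrazinAlgebra.

Section OperatorTheory.
Context (R : realType) (H : hilbertType R).
Implicit Types (S T P D E : boundedOp H) (x y : H).

Lemma inner_adjointl T x y : inner (adjoint T x) y = inner x (T y).
Proof. by rewrite innerC -adjointP -innerC. Qed.

Lemma adjointK T : adjoint (adjoint T) = T.
Proof. by apply: op_ext => y; apply: inner_inj => x; rewrite -adjointP inner_adjointl. Qed.

Lemma adjointM S T : adjoint (S * T) = adjoint T * adjoint S.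
Proof.
by apply: op_ext => y; apply: inner_inj => x; rewrite -adjointP !op_mulE !adjointP.
Qed.

Lemma adjoint1 : adjoint (1 : boundedOp H) = 1.
Proof. by apply: op_ext => y; apply: inner_inj => x; rewrite -adjointP. Qed.

Lemma adjointX T k : adjoint (T ^+ k) = adjoint T ^+ k.
Proof. by elim: k => [|k IH]; rewrite ?adjoint1 // exprS exprSr adjointM IH. Qed.

Lemma normal_norm_adjoint T x :
  adjoint T * T = T * adjoint T -> `|adjoint T x| = `|T x|.
Proof.
move=> nT; apply/eqP.
rewrite -(@eqrXn2 _ 2) // !inner_norm inner_adjointl adjointP.
by rewrite -!op_mulE nT.
Qed.

(** Normality turns [P (x - P x) = 0] into [adjoint P (x - P x) = 0]. Hence
    [adjoint P = adjoint P * P], and the right side is self-adjoint. *)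
Lemma normal_idempotent_selfadjoint P :
  P * P = P -> adjoint P * P = P * adjoint P -> adjoint P = P.
Proof.
move=> PP nP; have PsP : adjoint P = adjoint P * P.
  apply: op_ext => x; apply/eqP; rewrite op_mulE -subr_eq0 -linearB /=.
  by rewrite -normr_eq0 normal_norm_adjoint // linearB /= -op_mulE PP subrr normr0.
by have := adjointM (adjoint P) P; rewrite adjointK -PsP adjointK.
Qed.

Lemma contraction_le T x : op_contraction T -> `|T x| <= `|x|.
Proof.
move=> T1; apply: (le_trans (le_opnorm T x)).
by rewrite -[leRHS]mul1r ler_wpM2r // -[1]/((1 : R)%:C)%C lecR.
Qed.

Lemma contraction_expr_le T k x : op_contraction T -> `|(T ^+ k) x| <= `|x|.
Proof.
move=> T1; elim: k => [|k IH]; first by [].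
by rewrite exprS op_mulE (le_trans (contraction_le _ T1)).
Qed.

Lemma contraction_adjoint_le T y : op_contraction T -> `|adjoint T y| <= `|y|.
Proof.
move=> T1; have [->|y0] := eqVneq (adjoint T y) 0; first by rewrite normr0.
rewrite -(ler_pM2r (_ : 0 < `|adjoint T y|)) ?normr_gt0 // -expr2 inner_norm.
have i0 : 0 <= inner (T (adjoint T y)) y by rewrite adjointP dnorm_ge0.
rewrite inner_adjointl innerC (geC0_conj i0) -[leLHS]ger0_norm //.
apply: (le_trans (Cauchy_Schwarz _ _)); rewrite mulrC.
by apply: ler_wpM2l => //; exact: contraction_le.
Qed.

Lemma normB2 x y :
  `|x - y| ^+ 2 = `|x| ^+ 2 + `|y| ^+ 2 - (inner x y + (inner x y)^*).
Proof. by rewrite !inner_norm dnormB. Qed.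

(** The square of the norm of [x - adjoint T (T x)] expands to [|adjoint T (T x)|^2 - |x|^2], which
    is at most 0 because [adjoint T] is also contractive. *)
Lemma contraction_isometric_vector T x :
  op_contraction T -> `|x| <= `|T x| -> adjoint T (T x) = x.
Proof.
move=> T1 xT.
have Tx : `|T x| = `|x| by apply/le_anti; rewrite contraction_le.
apply/esym/eqP; rewrite -subr_eq0 -normr_le0.
rewrite -(ler_pXn2r (isT : (0 < 2)%N)) ?nnegrE // expr0n /=.
rewrite normB2 -adjointP -inner_norm geC0_conj ?exprn_ge0 // Tx.
rewrite opprD addrACA subrr add0r subr_le0 ler_pXn2r ?nnegrE // -Tx.
exact: contraction_adjoint_le.
Qed.

Lemma op_continuous T : continuous T.
Proof.
have [M M0 TM] := op_boundedE T.
move=> x; apply/cvgrPdist_lt => e e0.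
have M1 : 0 < (M%:C)%C + 1 :> R[i] by rewrite ltr_wpDl // ler0c.
near=> y; rewrite -linearB; apply: (le_lt_trans (TM _)).
apply: (@le_lt_trans _ _ (((M%:C)%C + 1) * `|x - y|)).
  by apply: ler_wpM2r => //; rewrite lerDl.
rewrite mulrC -ltr_pdivlMr //; near: y.
by apply: cvgr_dist_lt; rewrite ?divr_gt0.
Unshelve. all: by end_near. Qed.

Lemma op_ker_closed E : closed [set x | E x = 0].
Proof.
have -> : [set x | E x = 0] = E @^-1` [set 0] by [].
apply: closed_comp; first by move=> x _; exact: op_continuous.
exact: (accessible_closed_set1 (hausdorff_accessible (@norm_hausdorff _ H))).
Qed.

Lemma op_ker_submod E : GRing.submod_closed (mem [set x | E x = 0]).
Proof.
split=> [|a x y]; first by rewrite inE /= linear0.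
by rewrite !inE /= => Ex Ey; rewrite (op_linear E) Ex Ey scaler0 addr0.
Qed.

(** Serves for both summands: the range of an idempotent [P] is the kernel of [1 - P], so it is
    closed by continuity as well. *)
Definition op_ker E := ClosedSubspace (@op_ker_closed E) (op_ker_submod E).

Lemma op_kerP E (x : op_ker E) : E (val x) = 0.
Proof. by have := valP x; rewrite inE. Qed.

Lemma op_kerI E x : E x = 0 -> x \in csub_set (op_ker E).
Proof. by move=> Ex; rewrite inE. Qed.

Definition op_ker_mk E x (Ex : E x = 0) : op_ker E := exist _ x (op_kerI Ex).

Section Restriction.
Context (E S : boundedOp H) (ES : GRing.comm E S).

Lemma op_restr_subproof (x : op_ker E) : S (val x) \in csub_set (op_ker E).
Proof. by apply: op_kerI; rewrite -op_mulE ES op_mulE op_kerP linear0. Qed.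

Definition op_restr_fun (x : op_ker E) : op_ker E :=
  exist _ (S (val x)) (op_restr_subproof x).

Lemma op_restr_linear : linear op_restr_fun.
Proof. by move=> a x y; apply: val_inj; rewrite /= !linearP. Qed.

Lemma op_restr_bounded :
  exists M : R, forall x : op_ker E, `|op_restr_fun x| <= (M%:C)%C * `|x|.
Proof. by have [M SM] := op_bounded S; exists M => x; exact: SM. Qed.

Definition op_restr := BoundedOp op_restr_linear op_restr_bounded.

Lemma op_restrE (x : op_ker E) : val (op_restr x) = S (val x).
Proof. by []. Qed.

Lemma op_restrXE k (x : op_ker E) : val ((op_restr ^+ k) x) = (S ^+ k) (val x).
Proof. by elim: k => [//|k IH]; rewrite !exprS op_mulE op_restrE IH. Qed.

End Restriction.

End OperatorTheory.

Theorem proposition2p6 (R : realType) (H : hilbertType R)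
    (H_infinite_dim : infinite_dim H) (n m : nat) (n_ge1 : (1 <= n)%N)
    (m_ge1 : (1 <= m)%N) (T : boundedOp H) (T_contraction : op_contraction T)
    (T_DN : DN n m T) (T_partial_isometry : partial_isometry m T) :
  DN 1 1 T /\
  exists (H1 H0 : closedSubspace H) (U : boundedOp H1) (T0 : boundedOp H0),
    [/\ orthogonal_decomposition H1 H0, is_direct_sum T U T0,
        is_unitary U & is_nilpotent T0].
Proof.
have [D [/subr0_eq dt d2t [p p1 tp]] /subr0_eq dTs] := T_DN.
pose P := T * D.
have PP : P * P = P := drazin_idem dt d2t.
have TP : GRing.comm P T by rewrite /GRing.comm /P -mulrA dt.
have DP : D * P = D by rewrite /P -dt mulrA -expr2.
have PD : P * D = D by rewrite /P -dt -mulrA.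
have PX k : (1 <= k)%N -> T ^+ k * D ^+ k = P by exact: drazin_exprM.
have DTX k : D ^+ k * T ^+ k = T ^+ k * D ^+ k.
  by apply: commrX; apply: commr_sym; apply: commrX; exact: commr_sym.
have PDX k : (1 <= k)%N -> P * D ^+ k = D ^+ k.
  by case: k => // k _; rewrite exprS mulrA PD.
(* Here [a = D ^+ n] and [b = T ^+ n], whose product is [P]. *)
have PTsm : GRing.comm (adjoint T ^+ m) P.
  rewrite -(PX n n_ge1) -DTX.
  by apply: comm_group_idempotent => //; rewrite -?DTX // DTX PX // PDX.
have nP : adjoint P * P = P * adjoint P.
  (* The exponent [m * p] is at least [p], so [P] fixes [T ^+ (m * p)]; it is a multiple of [m], so
     [adjoint P] commutes with this power by the adjoint of [PTsm]. *)
  have mp : (p <= m * p)%N by rewrite leq_pmull.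
  have mp1 : (1 <= m * p)%N := leq_trans p1 mp.
  have PT : P * T ^+ (m * p) = T ^+ (m * p).
    rewrite -(subnKC mp) exprD mulrA; congr (_ * _).
    have -> : P * T ^+ p = T ^+ p * P by apply: commrX.
    by rewrite /P mulrA -exprSr.
  rewrite -[X in adjoint P * X](PX _ mp1) -[X in X * adjoint P](PX _ mp1).
  apply: comm_group_idempotent; rewrite ?(PX _ mp1) //.
  rewrite exprM; apply: commrX; rewrite /GRing.comm.
  by rewrite -(adjointK T) -adjointX -!adjointM -/P PTsm.
have sP : adjoint P = P := normal_idempotent_selfadjoint PP nP.
have PTs : GRing.comm P (adjoint T).
  by rewrite /GRing.comm -[X in X * _]sP -[X in _ = _ * X]sP -!adjointM TP.
have TsmP : adjoint T ^+ m * P = D ^+ m.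
  (* Flanking by [D ^+ m] turns the identity into [P * adjoint T ^+ m * P = D ^+ m]. *)
  have e := congr1 (fun X => D ^+ m * X * D ^+ m) T_partial_isometry.
  rewrite /= !mulrA DTX PX // -mulrA PX // -PTsm -mulrA PP in e.
  by rewrite e PDX.
have TsmTmP : adjoint T ^+ m * (T ^+ m * P) = P.
  have <- : P * T ^+ m = T ^+ m * P by apply: commrX.
  by rewrite mulrA TsmP DTX PX.
have TsTP : adjoint T * (T * P) = P.
  apply: op_ext => x; apply: contraction_isometric_vector => //.
  (* [T ^+ m] preserves the norm of [P x], and the last [m - 1] factors cannot increase it, so the
     first factor [T] cannot have decreased it. *)
  have -> : `|P x| = `|(T ^+ m) (P x)|.
    apply/eqP; rewrite -(@eqrXn2 _ 2) // !inner_norm (adjointP (T ^+ m)) adjointX.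
    by rewrite -[X in _ == X]/(inner (P x) ((adjoint T ^+ m * (T ^+ m * P)) x)) TsmTmP.
  by rewrite -(prednK m_ge1) exprSr op_mulE contraction_expr_le.
have TsP : adjoint T * P = D.
  by have := congr1 ( *%R^~ D) TsTP; rewrite /= -(mulrA _ (T * P)) -(mulrA T) PD.
have P1T S : GRing.comm P S -> GRing.comm (1 - P) S.
  by move=> PS; rewrite /GRing.comm mulrBl mulrBr PS mul1r mulr1.
have P1 (x : H) : (1 - P) x = 0 -> P x = x by move/subr0_eq.
split.
  exists D; first by split; [rewrite /commutator dt subrr| |exists p].
  (* [D = adjoint T * P] is a product of two operators that commute with [adjoint T]. *)
  by rewrite /commutator !expr1 -TsP -mulrA PTs subrr.
have PDc : GRing.comm P D by rewrite /GRing.comm PD DP.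
pose U := op_restr (P1T _ TP); pose V := op_restr (P1T _ PDc).
exists (op_ker (1 - P)), (op_ker P), U, (op_restr TP); split.
- split=> [x y|z].
    by rewrite -(P1 _ (op_kerP x)) -{1}sP inner_adjointl op_kerP linear0.
  have z1 : (1 - P) (P z) = 0.
    by rewrite -op_mulE mulrBl mul1r PP subrr.
  have z0 : P (z - P z) = 0.
    by rewrite -[LHS]/((P * (1 - P)) z) mulrBr mulr1 PP subrr.
  exists (op_ker_mk z1), (op_ker_mk z0).
  by rewrite /= subrKC.
- by move=> x y; rewrite linearD.
- have UU : adjoint U * U = 1.
    apply: op_ext => x; apply: inner_inj => z; rewrite op_mulE -adjointP.
    rewrite -[LHS]/(inner (T (val z)) (T (val x))) adjointP.
    rewrite -{1}(P1 _ (op_kerP x)).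
    rewrite -[LHS]/(inner (val z) ((adjoint T * (T * P)) (val x))) TsTP.
    by rewrite P1 ?op_kerP.
  (* The restriction [V] of [D] is a right inverse of [U], so the left inverse [adjoint U] is
     two-sided. *)
  have UV : U * V = 1.
    apply: op_ext => x; apply: val_inj.
    by rewrite op_mulE !op_restrE -op_mulE P1 ?op_kerP.
  by split=> //; rewrite -[adjoint U]mulr1 -UV mulrA UU mul1r.
- exists p => //; apply: op_ext => x; apply: val_inj.
  (* [T ^+ p = T ^+ p * P], which vanishes on the kernel of [P]. *)
  rewrite op_restrXE -tp exprSr -mulrA !op_mulE -[T (D _)]/(P (val x)).
  by rewrite op_kerP linear0.
Qed.
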